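(* Let $\Delta_k^{\mathrm{right}}(z)$ and $\Delta_k^{\mathrm{left}}(z)$, $k\ge1$, be the $2\times2$ matrix functions defined in the context, and define recursively for $m\ge1$ $$s_m^{\mathrm{right}}(z)=\Delta_m^{\mathrm{right}}(z)-\sum_{j=1}^{m-1}s_j^{\mathrm{right}}(z)\Delta_{m-j}^{\mathrm{right}}(z),\qquad s_m^{\mathrm{left}}(z)=\Delta_m^{\mathrm{left}}(z)-\sum_{j=1}^{m-1}s_j^{\mathrm{left}}(z)\Delta_{m-j}^{\mathrm{left}}(z).$$ Then for every odd $m\ge 1$ $$s_m^{\mathrm{right}}(z)=\Delta_m^{\mathrm{right}}(z),\qquad s_m^{\mathrm{left}}(z)=\Delta_m^{\mathrm{left}}(z),$$ and for every even $m\ge2$ $$s_m^{\mathrm{right}}(z)=\Delta_m^{\mathrm{right}}(z)-\frac{4\alpha^2+2m-1}{(\log\varphi(z))^m}\,\frac{(\alpha,m-1)}{2^{m+1}m}\,I,$$ $$s_m^{\mathrm{left}}(z)=\Delta_m^{\mathrm{left}}(z)-\frac{4\beta^2+2m-1}{(\log(-\varphi(z)))^m}\,\frac{(\beta,m-1)}{2^{m+1}m}\,I.$$ Here the ''right'' identities hold for $z$ in a neighbourhood of $1$ minus the interval $[-1,1]$, and the ''left'' identities for $z$ in a neighbourhood of $-1$ minus $[-1,1]$, i.e. where the respective $\Delta_k$ are defined.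
   Context: Let $\alpha,\beta>-1$ and let $h$ be real analytic and strictly positive on $[-1,1]$, analytic with positive real part in a complex neighbourhood $U$ of $[-1,1]$; $\log h$ is the branch that is real on $[-1,1]$. The branch of $(z^2-1)^{1/2}$ is analytic in $\mathbb C\setminus[-1,1]$ and behaves like $z$ at infinity. Set $\varphi(z)=z+(z^2-1)^{1/2}$. The logarithms are principal ($\log\varphi(z)$ near $z=1$, $\log(-\varphi(z))$ near $z=-1$). Let $U_\delta,\tilde U_\delta$ be small disks of radius $\delta$ around $1,-1$, and let $\gamma$ be a contour in the neighbourhood $U$ of $[-1,1]$ (where $h$ is analytic with positive real part) encircling $[-1,1]$ and both closed disks once in the positive direction. Put $$m(z)=\frac1{2\pi i}\oint_\gamma\frac{\log h(\zeta)}{(\zeta^2-1)^{1/2}}\frac{d\zeta}{\zeta-z},\qquad D_\infty=2^{-\frac{\alpha+\beta}2}\exp\Big(\frac1{4\pi i}\oint_\gamma\frac{\log h(\zeta)}{(\zeta^2-1)^{1/2}}d\zeta\Big),$$ $$F^{\mathrm{right}}(z)=\varphi(z)^{(\alpha+\beta)/2}\exp\big(\tfrac12(z^2-1)^{1/2}m(z)\big),\qquad F^{\mathrm{left}}(z)=(-\varphi(z))^{(\alpha+\beta)/2}\exp\big(\tfrac12(z^2-1)^{1/2}m(z)\big)$$ (principal powers; used near $1$ and near $-1$ respectively), $$M(z)=\frac12\begin{pmatrix}a(z)+a(z)^{-1}&-i(a(z)-a(z)^{-1})\\ i(a(z)-a(z)^{-1})&a(z)+a(z)^{-1}\end{pmatrix},\qquad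 a(z)=\Big(\frac{z-1}{z+1}\Big)^{1/4}\text{ (principal branch)}.$$ For a nonzero scalar $f$, $f^{\sigma_3}=\mathrm{diag}(f,f^{-1})$ and $f^{-\sigma_3}=\mathrm{diag}(f^{-1},f)$. Let $(q,0)=1$ and, for $m>0$, $$(q,m)=\frac{\prod_{n=1}^m(4q^2-(2n-1)^2)}{2^{2m}m!}.$$ For $k\ge1$ define, for $z\in U_\delta\setminus(1-\delta,1]$, $$\Delta_k^{\mathrm{right}}(z)=\frac{(\alpha,k-1)}{(2\log\varphi(z))^k}D_\infty^{\sigma_3}M(z)F^{\mathrm{right}}(z)^{\sigma_3}\begin{pmatrix}\frac{(-1)^k}{k}(\alpha^2+\frac k2-\frac14)&-i(k-\frac12)\\(-1)^k(k-\frac12)i&\frac1k(\alpha^2+\frac k2-\frac14)\end{pmatrix}F^{\mathrm{right}}(z)^{-\sigma_3}M(z)^{-1}D_\infty^{-\sigma_3},$$ and, for $z\in\tilde U_\delta\setminus[-1,-1+\delta)$, $$\Delta_k^{\mathrm{left}}(z)=\frac{(\beta,k-1)}{(2\log(-\varphi(z)))^k}D_\infty^{\sigma_3}M(z)F^{\mathrm{left}}(z)^{\sigma_3}\begin{pmatrix}\frac{(-1)^k}{k}(\beta^2+\frac k2-\frac14)&i(k-\frac12)\\(-1)^{k+1}(k-\frac12)i&\frac1k(\beta^2+\frac k2-\frac14)\end{pmatrix}F^{\mathrm{left}}(z)^{-\sigma_3}M(z)^{-1}D_\infty^{-\sigma_3}.$$ $I$ is the $2\times2$ identity matrix; empty sums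 are zero. *)

(* Defs.v *)
From HB Require Import structures.
From mathcomp Require Import all_boot all_order all_algebra.
From mathcomp Require Import all_classical all_reals all_analysis.
From mathcomp Require Import complex.

Set Implicit Arguments.
Unset Strict Implicit.
Unset Printing Implicit Defensive.

Import Order.TTheory GRing.Theory Num.Theory.
Import numFieldNormedType.Exports.

Local Open Scope classical_set_scope.
Local Open Scope ring_scope.
Local Open Scope complex_scope.

HB.instance Definition _ (R : rcfType) := NormedModule.copy R[i] (R[i]^o).

(* Num.Theory shadows the projections of R[i] by the R[i]-valued ones *)
Local Notation Re := complex.Re.
Local Notation Im := complex.Im.

Section ComplexFunctions.
Variable R : realType.
Local Notation C := R[i].

Definition holomorphic_on (U : set C) (f : C -> C) :=
  forall z, U z -> derivable f z 1.

Definition cexp (z : C) : C :=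
  (expR (Re z))%:C * (cos (Im z) +i* sin (Im z)).

Definition cmod (z : C) : R := Num.sqrt (Re z ^+ 2 + Im z ^+ 2).

(* principal argument, with values in ]-pi, pi] for z != 0 *)
Definition carg (z : C) : R :=
  if 0 <= Im z then acos (Re z / cmod z) else - acos (Re z / cmod z).

Definition clog (z : C) : C := ln (cmod z) +i* carg z.

Definition cpow (z s : C) : C := cexp (s * clog z).

Definition cderive (g : R -> C) (t : R) : C :=
  derive1 (fun x => Re (g x)) t +i* derive1 (fun x => Im (g x)) t.

Definition cintegral (A : set R) (f : R -> C) : C :=
  Rintegral lebesgue_measure A (fun t => Re (f t)) +i*
  Rintegral lebesgue_measure A (fun t => Im (f t)).

Definition contour_integral (g : R -> C) (f : C -> C) : C :=
  cintegral `[0, 1]%classic (fun t => f (g t) * cderive g t).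

Definition C1 (g : R -> C) :=
  [/\ forall t, derivable (fun x => Re (g x)) t 1,
      forall t, derivable (fun x => Im (g x)) t 1,
      continuous (derive1 (fun x => Re (g x))) &
      continuous (derive1 (fun x => Im (g x)))].

(* Asking for a global C1 function that extends each piece means that the
   piece is C1 up to its end points; g is then continuous on [0, 1]. *)
Definition piecewise_C1 (g : R -> C) :=
  exists (n : nat) (t : nat -> R),
    [/\ t 0%N = 0, t n = 1,
        forall j, (j < n)%N -> t j < t j.+1 &
        forall j, (j < n)%N ->
          exists2 G, C1 G & {in `[t j, t j.+1], g =1 G}].

Definition closed_contour (g : R -> C) := piecewise_C1 g /\ g 0 = g 1.

Definition winding_number (g : R -> C) (w : C) : C :=
  (2 * pi%:C * 'i)^-1 * contour_integral g (fun z => (z - w)^-1).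

Definition encircles_once (g : R -> C) (A : set C) :=
  forall w, A w ->
    (forall t, t \in `[0, 1] -> g t != w) /\ winding_number g w = 1.

Definition real_itv (i : interval R) : set C := [set x%:C | x in [set` i]].

Definition disk (c : C) (d : R) : set C := [set z | `|z - c| < d%:C].
Definition closed_disk (c : C) (d : R) : set C := [set z | `|z - c| <= d%:C].

(* r is the branch of (z^2-1)^(1/2) that is analytic off [-1, 1] and behaves
   like z at infinity *)
Definition is_sqrt_branch (r : C -> C) :=
  [/\ forall z, ~ real_itv `[-1, 1] z -> r z ^+ 2 = z ^+ 2 - 1,
      holomorphic_on (~` real_itv `[-1, 1]) r &
      forall e : R, 0 < e -> exists B : R,
        forall z, B%:C < `|z| -> `|r z / z - 1| < e%:C].

Definition is_log_branch (U : set C) (h logh : C -> C) :=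
  [/\ holomorphic_on U logh,
      forall z, U z -> cexp (logh z) = h z &
      forall x : R, x \in `[-1, 1] -> Im (logh x%:C) = 0].

End ComplexFunctions.

Section Expansion.
Variable R : realType.
Local Notation C := R[i].

Definition mx2 (a b c d : C) : 'M[C]_2 :=
  \matrix_(i, j) if i == 0 then (if j == 0 then a else b)
                 else (if j == 0 then c else d).

(* f^(sigma_3) and f^(-sigma_3) *)
Definition sigma3 (f : C) : 'M[C]_2 := mx2 f 0 0 f^-1.
Definition sigma3V (f : C) : 'M[C]_2 := mx2 f^-1 0 0 f.

(* the symbol (q, m); the value at m = 0 is 1 *)
Definition qsym (q : R) (m : nat) : R :=
  (\prod_(1 <= n < m.+1) (4 * q ^+ 2 - (2 * n%:R - 1) ^+ 2))
  / (2 ^+ (2 * m) * m`!%:R).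

Definition afun (z : C) : C := cpow ((z - 1) / (z + 1)) (4^-1).

Definition Mmx (z : C) : 'M[C]_2 :=
  2^-1 *: mx2 (afun z + (afun z)^-1) (- 'i * (afun z - (afun z)^-1))
              ('i * (afun z - (afun z)^-1)) (afun z + (afun z)^-1).

(* In what follows r stands for (z^2-1)^(1/2), logh for log h and g for the
   contour gamma. *)
Definition phi (r : C -> C) (z : C) : C := z + r z.

Definition mfun (r logh : C -> C) (g : R -> C) (z : C) : C :=
  (2 * pi%:C * 'i)^-1 *
  contour_integral g (fun zeta => logh zeta / r zeta * (zeta - z)^-1).

Definition Dinfty (alpha beta : R) (r logh : C -> C) (g : R -> C) : C :=
  (2 `^ (- ((alpha + beta) / 2)))%:C *
  cexp ((4 * pi%:C * 'i)^-1 *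
        contour_integral g (fun zeta => logh zeta / r zeta)).

Definition Fright (alpha beta : R) (r logh : C -> C) (g : R -> C) (z : C) : C :=
  cpow (phi r z) ((alpha + beta) / 2)%:C *
  cexp (2^-1 * r z * mfun r logh g z).

Definition Fleft (alpha beta : R) (r logh : C -> C) (g : R -> C) (z : C) : C :=
  cpow (- phi r z) ((alpha + beta) / 2)%:C *
  cexp (2^-1 * r z * mfun r logh g z).

Definition Delta_right (alpha beta : R) (r logh : C -> C) (g : R -> C)
    (k : nat) (z : C) : 'M[C]_2 :=
  let D := Dinfty alpha beta r logh g in
  let F := Fright alpha beta r logh g z in
  let d : R := k%:R^-1 * (alpha ^+ 2 + k%:R / 2 - 4^-1) in
  let e : R := k%:R - 2^-1 in
  ((qsym alpha k.-1)%:C / (2 * clog (phi r z)) ^+ k) *: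
  (sigma3 D *m Mmx z *m sigma3 F
   *m mx2 ((-1) ^+ k * d%:C) (- 'i * e%:C)
          ((-1) ^+ k * e%:C * 'i) d%:C
   *m sigma3V F *m invmx (Mmx z) *m sigma3V D).

Definition Delta_left (alpha beta : R) (r logh : C -> C) (g : R -> C)
    (k : nat) (z : C) : 'M[C]_2 :=
  let D := Dinfty alpha beta r logh g in
  let F := Fleft alpha beta r logh g z in
  let d : R := k%:R^-1 * (beta ^+ 2 + k%:R / 2 - 4^-1) in
  let e : R := k%:R - 2^-1 in
  ((qsym beta k.-1)%:C / (2 * clog (- phi r z)) ^+ k) *:
  (sigma3 D *m Mmx z *m sigma3 F
   *m mx2 ((-1) ^+ k * d%:C) ('i * e%:C)
          ((-1) ^+ k.+1 * e%:C * 'i) d%:C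
   *m sigma3V F *m invmx (Mmx z) *m sigma3V D).

(* s_upto Delta m z is the list of s_1(z), ..., s_m(z); the recursion that
   defines s_m is lemma s_fun_rec. *)
Fixpoint s_upto (Delta : nat -> C -> 'M[C]_2) (m : nat) (z : C)
    : seq 'M[C]_2 :=
  if m is m'.+1 then
    let s := s_upto Delta m' z in
    rcons s (Delta m z - \sum_(1 <= j < m) nth 0 s j.-1 *m Delta (m - j)%N z)
  else [::].

Definition s_fun (Delta : nat -> C -> 'M[C]_2) (m : nat) (z : C) : 'M[C]_2 :=
  nth 0 (s_upto Delta m z) m.-1.

Lemma size_s_upto Delta m z : size (s_upto Delta m z) = m.
Proof. by elim: m => //= m IH; rewrite size_rcons IH. Qed.

Lemma nth_s_upto Delta m j z : (0 < j <= m)%N ->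
  nth 0 (s_upto Delta m z) j.-1 = s_fun Delta j z.
Proof.
elim: m => [|m IH]; first by case: j.
case/andP=> j0; rewrite leq_eqVlt => /orP[/eqP->//|jm].
by rewrite /= nth_rcons size_s_upto prednK// -ltnS jm IH// j0.
Qed.

Lemma s_fun_rec Delta m z : (0 < m)%N ->
  s_fun Delta m z =
  Delta m z - \sum_(1 <= j < m) s_fun Delta j z *m Delta (m - j)%N z.
Proof.
case: m => // m _; rewrite {1}/s_fun /= nth_rcons size_s_upto ltnn eqxx.
congr (_ - _); apply: eq_big_nat => j /andP[j0 jm].
by rewrite nth_s_upto// j0.
Qed.

End Expansion.

(* Main.v *)
(* Up to a common conjugation by an invertible matrix, and with x = 1/(2L),
   L = log phi, the generating series I + sum_k Delta_k is
     T(x) = [[a(-x), -i b(x)], [i b(-x), a(x)]],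
   where a - b = u and a + b = u + x (2 theta + 1) u for u = sum_j (q, j) x^j and
   theta = x d/dx.  The determinant a(x) a(-x) - b(x) b(-x) is a Wronskian of
   the two formal Bessel solutions u(x) and u(-x), hence equals 1.  The recursion
   says that I - sum_m s_m is the inverse of T, which is therefore the adjugate
   of T; comparing the entries of T and of its adjugate gives both identities.
   At the left end point i is replaced by -i. *)
Require Import Defs.
From mathcomp Require Import all_boot all_order all_algebra.
From mathcomp Require Import all_classical all_reals all_analysis.
From mathcomp Require Import complex.
From mathcomp Require Import ring.
Import Order.TTheory GRing.Theory Num.Theory.
Import numFieldNormedType.Exports.
Local Open Scope classical_set_scope.
Local Open Scope ring_scope.
Local Open Scope complex_scope.

(** * Convolution sums and the Wronskian of the Bessel series *)

Lemma sum_antidiag_recl (V : nmodType) (f : nat -> nat -> V) n :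
  \sum_(j < n.+2) f j (n.+1 - j)%N =
  f 0%N n.+1 + \sum_(j < n.+1) f j.+1 (n - j)%N.
Proof. by rewrite big_ord_recl subn0; congr (_ + _); apply: eq_bigr. Qed.

Lemma sum_antidiag_recr (V : nmodType) (f : nat -> nat -> V) n :
  \sum_(j < n.+2) f j (n.+1 - j)%N =
  \sum_(j < n.+1) f j (n - j).+1 + f n.+1 0%N.
Proof.
rewrite big_ord_recr /= subnn; congr (_ + _).
by apply: eq_bigr => j _; rewrite subSn// -ltnS.
Qed.

Lemma sum_antidiag_rev (V : nmodType) (f : nat -> nat -> V) n :
  \sum_(j < n.+1) f j (n - j)%N = \sum_(j < n.+1) f (n - j)%N j.
Proof.
rewrite (reindex_inj rev_ord_inj); apply: eq_bigr => j _ /=.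
by rewrite subSS subKn// -ltnS.
Qed.

(* the coefficients of the series a and b above, when [u j] is (q, j) *)
Section Coefficients.
Variables (F : numFieldType) (u : nat -> F).

(** Since [a = u + b], the relations above say $b = x(\theta + 1/2)u$; the factor $x$ shifts the
    index and makes the constant term 0. *)
Definition bcoef (j : nat) : F :=
  if j is i.+1 then (i%:R + 2^-1) * u i else 0.

Definition acoef (j : nat) : F := u j + bcoef j.

(* With [theta = x d/dx] the recurrence for [u] is the Bessel equation
   [4 theta u = x (4 q^2 - (2 theta + 1)^2) u]; the sum is the coefficient of
   [x^(n+1)] in the constant Wronskian of [u(x)] and [u(-x)]. *)
Lemma wronskian_coef (q : F) :
    (forall j, 4 * j.+1%:R * u j.+1 = (4 * q ^+ 2 - (2 * j%:R + 1) ^+ 2) * u j) ->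
  forall n, \sum_(j < n.+2) (-1) ^+ (n.+1 - j) *
    (acoef j * acoef (n.+1 - j) - bcoef j * bcoef (n.+1 - j)) = 0.
Proof.
move=> rec n.
pose K (i : nat) : F := q ^+ 2 - (i%:R + 2^-1) ^+ 2.
have {}rec j : j.+1%:R * u j.+1 = K j * u j.
  apply: (@mulfI F 4); first by rewrite pnatr_eq0.
  by rewrite mulrA rec /K; field.
(* As [a = u + b], the products of two [bcoef] cancel. *)
have split3 : \sum_(j < n.+2) (-1) ^+ (n.+1 - j) *
    (acoef j * acoef (n.+1 - j) - bcoef j * bcoef (n.+1 - j)) =
  \sum_(j < n.+2) (-1) ^+ (n.+1 - j) * (u j * u (n.+1 - j)%N) +
  (\sum_(j < n.+2) (-1) ^+ (n.+1 - j) * (bcoef j * u (n.+1 - j)%N) +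
   \sum_(j < n.+2) (-1) ^+ (n.+1 - j) * (u j * bcoef (n.+1 - j))).
  rewrite -!big_split; apply: eq_bigr => j _ /=.
  by rewrite /acoef; ring.
(* multiply the coefficient of x^(n+1) by n+1, i.e. apply theta *)
have euler : n.+1%:R *
    \sum_(j < n.+2) (-1) ^+ (n.+1 - j) * (u j * u (n.+1 - j)%N) =
  \sum_(j < n.+2) (-1) ^+ (n.+1 - j) * ((j%:R * u j) * u (n.+1 - j)%N) +
  \sum_(j < n.+2) (-1) ^+ (n.+1 - j) *
    (u j * ((n.+1 - j)%:R * u (n.+1 - j)%N)).
  rewrite -big_split big_distrr; apply: eq_bigr => j _ /=.
  have -> : n.+1%:R = j%:R + (n.+1 - j)%:R :> F.
    by rewrite -natrD subnKC// -ltnS.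
  by ring.
apply: (@mulfI F n.+1%:R); first by rewrite pnatr_eq0.
rewrite mulr0 split3 mulrDr euler.
(* Each sum loses an end term that is zero, through a factor $0$ or [bcoef u 0], and so becomes a
   sum over $j + l = n$. *)
rewrite (sum_antidiag_recl _ (fun j l => (-1) ^+ l * (j%:R * u j * u l))).
rewrite (sum_antidiag_recr _ (fun j l => (-1) ^+ l * (u j * (l%:R * u l)))).
rewrite (sum_antidiag_recl _ (fun j l => (-1) ^+ l * (bcoef j * u l))).
rewrite (sum_antidiag_recr _ (fun j l => (-1) ^+ l * (u j * bcoef l))).
rewrite /= !(mul0r, mulr0, add0r, addr0) mulrDr !big_distrr -!big_split /=.
(* With $l = n - j$, the coefficient of $(-1)^l u_j u_l$ is $K_j - K_l + (n+1)(j-l)$. It vanishes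
   because $K_j - K_l = (l-j)(l+j+1)$. *)
apply: big1 => j _; rewrite !rec exprS /K.
have -> : n.+1%:R = j%:R + (n - j)%:R + 1 :> F.
  by rewrite -natr1 -natrD subnKC // -ltnS.
by field.
Qed.

End Coefficients.

Arguments bcoef {F} u j.
Arguments acoef {F} u j.

(** This is the recurrence that [wronskian_coef] assumes: the new factor has $n = j+1$, so $2n-1 =
    2j+1$. *)
Lemma qsymS (R : realType) (q : R) j :
  4 * j.+1%:R * qsym q j.+1 = (4 * q ^+ 2 - (2 * j%:R + 1) ^+ 2) * qsym q j.
Proof.
rewrite /qsym big_nat_recr//= factS natrM mulnS exprD.
have := pnatr_eq0 R j`!; rewrite -leqn0 leqNgt fact_gt0 /= => /negbT f0.
have p0 : 2 ^+ (2 * j) != 0 :> R by rewrite expf_neq0// pnatr_eq0.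
have j0 : j.+1%:R != 0 :> R by rewrite pnatr_eq0.
by move: j0; rewrite -natr1 => j0; field; rewrite p0 f0.
Qed.

(** * Arithmetic of 2 by 2 matrices and invertibility of the conjugating factors *)

Section TwoByTwo.
Variable R : realType.
Local Notation C := R[i].

Lemma mx2P (a b c d a' b' c' d' : C) :
  a = a' -> b = b' -> c = c' -> d = d' -> mx2 a b c d = mx2 a' b' c' d'.
Proof. by move=> -> -> -> ->. Qed.

Lemma mx2_eta (A : 'M[C]_2) : A = mx2 (A 0 0) (A 0 1) (A 1 0) (A 1 1).
Proof.
apply/matrixP => i j; rewrite mxE.
by case: i j => [[|[|//]] ?] [[|[|//]] ?] /=; congr (A _ _); apply: val_inj.
Qed.

Lemma mulmx2 (a b c d a' b' c' d' : C) :
  mx2 a b c d *m mx2 a' b' c' d' =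
  mx2 (a * a' + b * c') (a * b' + b * d') (c * a' + d * c') (c * b' + d * d').
Proof.
by rewrite [LHS]mx2_eta !mxE !big_ord_recl !big_ord0 !mxE /= !addr0.
Qed.

Lemma addmx2 (a b c d a' b' c' d' : C) :
  mx2 a b c d + mx2 a' b' c' d' = mx2 (a + a') (b + b') (c + c') (d + d').
Proof. by rewrite [LHS]mx2_eta !mxE. Qed.

Lemma oppmx2 (a b c d : C) : - mx2 a b c d = mx2 (- a) (- b) (- c) (- d).
Proof. by rewrite [LHS]mx2_eta !mxE. Qed.

Lemma scalemx2 (x a b c d : C) :
  x *: mx2 a b c d = mx2 (x * a) (x * b) (x * c) (x * d).
Proof. by rewrite [LHS]mx2_eta !mxE. Qed.

Lemma scalar_mx2 (x : C) : x%:M = mx2 x 0 0 x.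
Proof. by rewrite [LHS]mx2_eta !mxE. Qed.

Lemma sum_mx2 n (a b c d : 'I_n -> C) :
  \sum_i mx2 (a i) (b i) (c i) (d i) =
  mx2 (\sum_i a i) (\sum_i b i) (\sum_i c i) (\sum_i d i).
Proof.
by rewrite [LHS]mx2_eta !summxE; apply: mx2P; apply: eq_bigr => i _; rewrite mxE.
Qed.

Lemma cexp_neq0 (z : C) : cexp z != 0.
Proof.
rewrite mulf_neq0//; first by rewrite fmorph_eq0 gt_eqF ?expR_gt0.
apply/eqP => -[c0 s0].
by have := cos2Dsin2 (complex.Im z); rewrite c0 s0 expr0n addr0 => /eqP;
  rewrite eq_sym oner_eq0.
Qed.

Lemma cpow_neq0 (z s : C) : cpow z s != 0.
Proof. exact: cexp_neq0. Qed.

Lemma Dinfty_neq0 (alpha beta : R) r logh g :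
  Dinfty alpha beta r logh g != 0.
Proof.
by rewrite mulf_neq0 ?cexp_neq0// fmorph_eq0 gt_eqF// powR_gt0.
Qed.

Lemma sigma3K (f : C) : f != 0 -> sigma3V f *m sigma3 f = 1%:M.
Proof.
by move=> f0; rewrite mulmx2 scalar_mx2; apply: mx2P; field.
Qed.

(** The determinant is $((a+a^{-1})^2 - (a-a^{-1})^2)/4 = 1$, and the adjugate serves as inverse. *)
Lemma Mmx_unit (z : C) : Mmx z \in unitmx.
Proof.
have a0 : afun z != 0 by exact: cpow_neq0.
have i2 : 'i * 'i = -1 :> C by rewrite -expr2 sqr_i.
pose p := afun z + (afun z)^-1; pose q := afun z - (afun z)^-1.
suff /mulmx1_unit[U _] : Mmx z *m (2^-1 *: mx2 p ('i * q) (- 'i * q) p) = 1%:M.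
  exact: U.
rewrite /Mmx -/p -/q !scalemx2 mulmx2 scalar_mx2.
have pq : 2^-1 * p * (2^-1 * p) - 2^-1 * q * (2^-1 * q) = 1 :> C.
  by rewrite /p /q; field.
by apply: mx2P; rewrite -?[RHS]pq; ring: i2.
Qed.

End TwoByTwo.

(** * The recursion as inversion of a matrix power series *)

(** In each product $s_j\Delta_{m-j}$ the inner factor $QP$ cancels and the powers of $x$ combine to
    $x^m$. The recursion thus becomes the one that $NT = I$ imposes on $-N_m$. *)
Lemma s_fun_inverse (R : realType) (N T : nat -> 'M[R[i]]_2)
    (P Q : 'M[R[i]]_2) (x z : R[i]) (Delta : nat -> R[i] -> 'M[R[i]]_2) :
    N 0%N = 1%:M -> T 0%N = 1%:M ->
    (forall n, \sum_(j < n.+2) N j *m T (n.+1 - j)%N = 0) ->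
    Q *m P = 1%:M ->
    (forall k, (0 < k)%N -> Delta k z = x ^+ k *: (P *m T k *m Q)) ->
  forall m, (0 < m)%N -> s_fun Delta m z = x ^+ m *: (P *m - N m *m Q).
Proof.
move=> N0 T0 NT QP DeltaE m.
elim/ltn_ind: m => -[//|n] IH _; rewrite s_fun_rec// DeltaE//.
have -> : \sum_(1 <= j < n.+1) s_fun Delta j z *m Delta (n.+1 - j)%N z =
    - (x ^+ n.+1 *: (P *m (\sum_(1 <= j < n.+1) N j *m T (n.+1 - j)%N) *m Q)).
  rewrite mulmx_sumr mulmx_suml scaler_sumr -sumrN.
  apply: eq_big_nat => j /andP[j0 jn].
  rewrite IH// DeltaE ?subn_gt0// -scalemxAl -scalemxAr scalerA -exprD.
  rewrite subnKC; last exact: ltnW.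
  by rewrite mulmxN mulNmx mulNmx scalerN -!mulmxA (mulmxA Q P) QP mul1mx.
have := NT n; rewrite -(big_mkord xpredT (fun j => N j *m T (n.+1 - j)%N)).
rewrite big_nat_recr// big_ltn// subn0 subnn N0 T0 mul1mx mulmx1 => conv0.
rewrite opprK -scalerDr -mulmxDl -mulmxDr.
suff -> : - N n.+1 = T n.+1 + \sum_(1 <= j < n.+1) N j *m T (n.+1 - j)%N by [].
by apply/esym/eqP; rewrite -addr_eq0 conv0.
Qed.

Section Recursion.
Variables (R : realType) (u : nat -> R[i]) (q c : R[i]).
(* [c] is ['i] at the right end point and [- 'i] at the left one. *)
Hypothesis c2 : c * c = -1.
Hypothesis u0 : u 0%N = 1.
Hypothesis urec : forall j,
  4 * j.+1%:R * u j.+1 = (4 * q ^+ 2 - (2 * j%:R + 1) ^+ 2) * u j.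

(** When [u j] is $(q,j)$ and $j \ge 1$, this is $(q,j-1)$ times the middle matrix of $\Delta_j$. *)
Definition Tmx (j : nat) : 'M[R[i]]_2 :=
  mx2 ((-1) ^+ j * acoef u j) (- c * bcoef u j)
      ((-1) ^+ j * c * bcoef u j) (acoef u j).

(* the coefficients of the inverse of the series [\sum_j Tmx j x^j], which is
   its adjugate because the determinant is 1 *)
Definition Nmx (j : nat) : 'M[R[i]]_2 :=
  mx2 (acoef u j) (c * bcoef u j)
      (- ((-1) ^+ j * c * bcoef u j)) ((-1) ^+ j * acoef u j).

Lemma Tmx0 : Tmx 0 = 1%:M.
Proof.
by rewrite /Tmx /acoef /bcoef u0 scalar_mx2; apply: mx2P; ring.
Qed.

Lemma Nmx0 : Nmx 0 = 1%:M.
Proof.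
by rewrite /Nmx /acoef /bcoef u0 scalar_mx2; apply: mx2P; ring.
Qed.

(** The diagonal entries are the Wronskian coefficient, the lower one after reversing the sum; the
    off-diagonal ones cancel because convolution is commutative. *)
Lemma sum_Nmx_Tmx n : \sum_(j < n.+2) Nmx j *m Tmx (n.+1 - j) = 0.
Proof.
have W := wronskian_coef _ u q urec n.
have ab : \sum_(j < n.+2) acoef u j * bcoef u (n.+1 - j) =
          \sum_(j < n.+2) bcoef u j * acoef u (n.+1 - j).
  rewrite (sum_antidiag_rev _ (fun j l => acoef u j * bcoef u l)).
  by apply: eq_bigr => j _; rewrite mulrC.
have sg (j : 'I_n.+2) : (-1) ^+ j * (-1) ^+ (n.+1 - j) = (-1) ^+ n.+1 :> R[i].
  by rewrite -exprD subnKC// -ltnS.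
under eq_bigr do rewrite mulmx2.
rewrite sum_mx2; transitivity (mx2 (0 : R[i]) 0 0 0);
  last by rewrite [RHS]mx2_eta !mxE.
apply: mx2P.
- by rewrite -[RHS]W; apply: eq_bigr => j _; ring: c2.
- transitivity (c * (\sum_(j < n.+2) bcoef u j * acoef u (n.+1 - j) -
                     \sum_(j < n.+2) acoef u j * bcoef u (n.+1 - j))).
    by rewrite -sumrB big_distrr; apply: eq_bigr => j _ /=; ring.
  by rewrite ab subrr mulr0.
- transitivity ((-1) ^+ n.+1 * c *
    (\sum_(j < n.+2) acoef u j * bcoef u (n.+1 - j) -
     \sum_(j < n.+2) bcoef u j * acoef u (n.+1 - j))).
    rewrite -sumrB big_distrr; apply: eq_bigr => j _ /=.
    by rewrite -(sg j); ring.
  by rewrite ab subrr mulr0.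
- rewrite -[RHS]W.
  rewrite (sum_antidiag_rev _ (fun j l => (-1) ^+ l *
    (acoef u j * acoef u l - bcoef u j * bcoef u l))).
  by apply: eq_bigr => j _; ring: c2.
Qed.

Variables (P Q : 'M[R[i]]_2) (x z : R[i]) (Delta : nat -> R[i] -> 'M[R[i]]_2).
Hypothesis QP : Q *m P = 1%:M.
Hypothesis DeltaE : forall k, (0 < k)%N ->
  Delta k z = x ^+ k *: (P *m Tmx k *m Q).

Lemma s_fun_odd m : odd m -> s_fun Delta m z = Delta m z.
Proof.
move=> om; have m0 : (0 < m)%N by case: m om.
rewrite (s_fun_inverse _ _ _ _ _ _ _ _ Nmx0 Tmx0 sum_Nmx_Tmx QP DeltaE)//.
(* For odd indices the adjugate differs from the matrix only by sign. *)
rewrite (DeltaE _ m0); suff -> : Tmx m = - Nmx m by [].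
by rewrite /Nmx /Tmx -signr_odd om oppmx2; apply: mx2P; ring.
Qed.

Lemma s_fun_even m : (0 < m)%N -> ~~ odd m ->
  s_fun Delta m z = Delta m z - (2 * acoef u m * x ^+ m)%:M.
Proof.
move=> m0 /negbTE em.
rewrite (s_fun_inverse _ _ _ _ _ _ _ _ Nmx0 Tmx0 sum_Nmx_Tmx QP DeltaE)//.
(* For even $m$, $T_m + N_m = 2a_m I$, and a scalar matrix is unchanged by conjugation. *)
have -> : (2 * acoef u m * x ^+ m)%:M =
    x ^+ m *: (P *m (2 * acoef u m)%:M *m Q).
  rewrite mul_mx_scalar -scalemxAl (mulmx1C QP) scalerA.
  by rewrite scalemx1 mulrC.
rewrite (DeltaE _ m0) -scalerBr -mulmxBl -mulmxBr.
suff -> : Tmx m - (2 * acoef u m)%:M = - Nmx m by [].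
rewrite /Nmx /Tmx -signr_odd em scalar_mx2 !oppmx2 addmx2.
by apply: mx2P; ring.
Qed.

End Recursion.

(** * Both end points at once: $\Delta_k$ in the form required by the recursion *)

Section LocalExpansion.
Variables (R : realType) (q : R) (c L D F z : R[i]).
Variable Delta : nat -> R[i] -> 'M[R[i]]_2.
Hypotheses (c2 : c * c = -1) (D0 : D != 0) (F0 : F != 0).
Hypothesis DeltaE : forall k, Delta k z =
  ((qsym q k.-1)%:C / (2 * L) ^+ k) *:
  (sigma3 D *m Mmx z *m sigma3 F
   *m mx2 ((-1) ^+ k * (k%:R^-1 * (q ^+ 2 + k%:R / 2 - 4^-1))%:C)
            (- c * (k%:R - 2^-1)%:C)
            ((-1) ^+ k * (k%:R - 2^-1)%:C * c)
            (k%:R^-1 * (q ^+ 2 + k%:R / 2 - 4^-1))%:C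
   *m sigma3V F *m invmx (Mmx z) *m sigma3V D).

Let u (j : nat) : R[i] := (qsym q j)%:C.
Let P := sigma3 D *m Mmx z *m sigma3 F.
Let Q := sigma3V F *m invmx (Mmx z) *m sigma3V D.

Let QP : Q *m P = 1%:M.
Proof.
rewrite /Q /P -!mulmxA (mulmxA (sigma3V D)) sigma3K// mul1mx.
by rewrite (mulmxA (invmx _)) mulVmx ?Mmx_unit// mul1mx sigma3K.
Qed.

Let u0 : u 0%N = 1.
Proof. by rewrite /u /qsym big_geq// muln0 expr0 fact0 mulr1 divr1. Qed.

Let urec j :
  4 * j.+1%:R * u j.+1 = (4 * q%:C ^+ 2 - (2 * j%:R + 1) ^+ 2) * u j.
Proof.
have /(congr1 (fun t : R => t%:C)) := qsymS _ q j.
by rewrite /u !(rmorphM, rmorphB, rmorphD, rmorphXn, rmorph_nat, rmorph1).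
Qed.

Let bcoefE k : bcoef u k.+1 = u k * (k.+1%:R - 2^-1)%:C.
Proof.
rewrite /bcoef mulrC !(rmorphB, fmorphV, rmorph_nat) -natr1.
by congr (_ * _); field.
Qed.

(** With $m = k+1$, the recurrence gives $q^2 - (k+\frac12)^2 + m(k+\frac12) = q^2 + \frac m2 -
    \frac14$ for $m\,a_m/u_k$. *)
Let acoefE k :
  acoef u k.+1 = u k * (k.+1%:R^-1 * (q ^+ 2 + k.+1%:R / 2 - 4^-1))%:C.
Proof.
have k0 : k.+1%:R != 0 :> R[i] by rewrite pnatr_eq0.
apply: (@mulfI _ (4 * k.+1%:R)); first by rewrite mulf_neq0// pnatr_eq0.
rewrite /acoef mulrDr urec bcoefE.
rewrite !(rmorphM, rmorphB, rmorphD, rmorphXn, fmorphV, rmorph_nat) /=.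
by move: k0; rewrite -!natr1 => k0; field.
Qed.

Let DeltaT k : (0 < k)%N ->
  Delta k z = (2 * L)^-1 ^+ k *: (P *m Tmx _ u c k *m Q).
Proof.
case: k => [//|k] _; rewrite DeltaE succnK -exprVn.
set A := mx2 _ _ _ _; have -> : Tmx _ u c k.+1 = u k *: A.
  by rewrite /A scalemx2 /Tmx acoefE bcoefE; apply: mx2P; ring.
have conj (A1 A2 A3 B1 B2 B3 : 'M[R[i]]_2) :
    A1 *m A2 *m A3 *m (u k *: A) *m (B1 *m B2 *m B3) =
    u k *: (A1 *m A2 *m A3 *m A *m B1 *m B2 *m B3).
  by rewrite -scalemxAr -scalemxAl !mulmxA.
rewrite [_%:C * _]mulrC -scalerA; apply: (congr1 (fun X => _ *: X)).
exact/esym/conj.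
Qed.

Lemma s_fun_Delta_odd m : odd m -> s_fun Delta m z = Delta m z.
Proof. exact: (s_fun_odd _ u q%:C c c2 u0 urec P Q _ z _ QP DeltaT). Qed.

Lemma s_fun_Delta_even m : (0 < m)%N -> ~~ odd m ->
  s_fun Delta m z = Delta m z -
    ((4 * q ^+ 2 + 2 * m%:R - 1)%:C / L ^+ m *
     (qsym q m.-1 / (2 ^+ m.+1 * m%:R))%:C)%:M.
Proof.
move=> m0 em.
rewrite (s_fun_even _ u q%:C c c2 u0 urec P Q _ z _ QP DeltaT)//.
congr (_ - _%:M); case: m m0 {em} => // k _ /=.
have -> : (qsym q k / (2 ^+ k.+2 * k.+1%:R))%:C =
    u k / (2 * 2 ^+ k.+1 * k.+1%:R) :> R[i].
  by rewrite /u; move: (qsym q k) => w; rewrite rmorphM fmorphV rmorphM rmorphXn !rmorph_nat exprS.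
(* The constant arises from $2a_m(2L)^{-m}$ with $a_m = u_k(4q^2+2m-1)/(4m)$ and $m = k+1$. *)
rewrite acoefE; move: (u k) => v.
rewrite !(rmorph_nat, rmorph1, rmorphXn, rmorphM, rmorphB, rmorphD, fmorphV) /=.
have k0 : k.+1%:R != 0 :> R[i] by rewrite pnatr_eq0.
have p0 : 2 ^+ k.+1 != 0 :> R[i] by rewrite expf_neq0// pnatr_eq0.
rewrite exprVn exprMn invfM; move: (2 ^+ k.+1) (L ^+ k.+1)^-1 p0 => s t s0.
by move: k0; rewrite -natr1 => k0; field; rewrite s0 k0.
Qed.

End LocalExpansion.

Theorem proposition4p2 (R : realType) (alpha beta : R)
  (h : R[i] -> R[i]) (U : set R[i])
  (logh r : R[i] -> R[i]) (delta : R) (gamma : R -> R[i])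
  (halpha : -1 < alpha) (hbeta : -1 < beta)
  (Uopen : open U) (Uitv : real_itv `[-1, 1] `<=` U)
  (hhol : holomorphic_on U h)
  (hRe : forall z, U z -> 0 < complex.Re (h z))
  (hpos : forall x : R, x \in `[-1, 1] -> 0 < h x%:C)
  (hlog : is_log_branch U h logh)
  (hr : is_sqrt_branch r)
  (hdelta : 0 < delta < 1)
  (gclosed : closed_contour gamma)
  (gU : forall t : R, t \in `[0, 1] -> U (gamma t))
  (gonce : encircles_once gamma
    (real_itv `[-1, 1] `|` closed_disk 1 delta `|` closed_disk (-1) delta)) :
  let Dright := Delta_right alpha beta r logh gamma in
  let Dleft := Delta_left alpha beta r logh gamma in
  let dom_right := disk 1 delta `\` real_itv `]1 - delta, 1] in
  let dom_left := disk (-1) delta `\` (real_itv `[-1, -1 + delta[) in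
  (forall m : nat, (0 < m)%N -> odd m ->
    (forall z, dom_right z -> s_fun Dright m z = Dright m z) /\
    (forall z, dom_left z -> s_fun Dleft m z = Dleft m z)) /\
  (forall m : nat, (0 < m)%N -> ~~ odd m ->
    (forall z, dom_right z ->
      s_fun Dright m z = Dright m z -
        ((4 * alpha ^+ 2 + 2 * m%:R - 1)%:C / clog (phi r z) ^+ m *
         (qsym alpha m.-1 / (2 ^+ m.+1 * m%:R))%:C)%:M) /\
    (forall z, dom_left z ->
      s_fun Dleft m z = Dleft m z -
        ((4 * beta ^+ 2 + 2 * m%:R - 1)%:C / clog (- phi r z) ^+ m *
         (qsym beta m.-1 / (2 ^+ m.+1 * m%:R))%:C)%:M)).

Proof.
have i2 : 'i * 'i = -1 :> R[i] by rewrite -expr2 sqr_i.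
have Ni2 : - 'i * - 'i = -1 :> R[i] by rewrite mulrNN.
have D0 := Dinfty_neq0 _ alpha beta r logh gamma.
have Fr0 z : Fright alpha beta r logh gamma z != 0.
  exact: mulf_neq0 (cpow_neq0 _ _ _) (cexp_neq0 _ _).
have Fl0 z : Fleft alpha beta r logh gamma z != 0.
  exact: mulf_neq0 (cpow_neq0 _ _ _) (cexp_neq0 _ _).
move=> Dright Dleft dom_right dom_left.
have rightE z k : Dright k z = _ := erefl.
(* The left matrix is the right one with $c = -i$: $i = -c$ and $(-1)^{k+1}i = (-1)^k c$. *)
have leftE z k : Dleft k z =
  ((qsym beta k.-1)%:C / (2 * clog (- phi r z)) ^+ k) *:
  (sigma3 (Dinfty alpha beta r logh gamma) *m Mmx z
   *m sigma3 (Fleft alpha beta r logh gamma z)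
   *m mx2 ((-1) ^+ k * (k%:R^-1 * (beta ^+ 2 + k%:R / 2 - 4^-1))%:C)
            (- - 'i * (k%:R - 2^-1)%:C)
            ((-1) ^+ k * (k%:R - 2^-1)%:C * - 'i)
            (k%:R^-1 * (beta ^+ 2 + k%:R / 2 - 4^-1))%:C
   *m sigma3V (Fleft alpha beta r logh gamma z) *m invmx (Mmx z)
   *m sigma3V (Dinfty alpha beta r logh gamma)).
  have sgn : (-1) ^+ k * (k%:R - 2^-1)%:C * - 'i =
      (-1) ^+ k.+1 * (k%:R - 2^-1)%:C * 'i :> R[i].
    by rewrite exprS mulN1r !mulNr mulrN.
  by rewrite sgn (opprK 'i).
split=> m m0 om; split=> z _.
- exact: (s_fun_Delta_odd _ alpha 'i _ _ _ z _ i2 D0 (Fr0 z) (rightE z)).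
- exact: (s_fun_Delta_odd _ beta (- 'i) _ _ _ z _ Ni2 D0 (Fl0 z) (leftE z)).
- exact: (s_fun_Delta_even _ alpha 'i _ _ _ z _ i2 D0 (Fr0 z) (rightE z)).
- exact: (s_fun_Delta_even _ beta (- 'i) _ _ _ z _ Ni2 D0 (Fl0 z) (leftE z)).
Qed.
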